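(* Let $M\in\mathcal M^{\circ,0}$. Let $\xi_0,\ldots,\xi_J$ be i.i.d. random variables on $(\widetilde\Omega,\widetilde{\mathcal F},\widetilde{\mathsf P})$ with values in $(-\infty,1]$, independent of $\mathcal F$, with $\widetilde{\mathsf E}[\xi_j]=0$, and whose common law has a density $p$ supported on $(-\infty,1]$, continuous on $(-\infty,1]$, with $p(1)>0$. Put $$\eta_j=\xi_j\left(Y_j^{\star}-Z_j+A_j^{\star}\right),\quad 0\le j\le J,\qquad \widetilde M_j=M_j-\eta_j .$$ Then the $\eta_j$ satisfy $\eta_j\le Y_j^{\star}-Z_j+A_j^{\star}$ $\widetilde{\mathsf P}$-a.s. for $j=0,\ldots,J$, so that $\widetilde{\mathsf E}\left[\max_{0\le j\le J}(Z_j-\widetilde M_j)\right]\ge Y_0^{\star}$; and if $M\ne M^{\star}$ with positive probability, then $$\widetilde{\mathsf E}\left[\max_{0\le j\le J}(Z_j-\widetilde M_j)\right]>Y_0^{\star}.$$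
   Context: $J\in\mathbb N_+$; $(\Omega,\mathcal F,\mathsf P)$ is a probability space with discrete filtration $(\mathcal F_j)_{0\le j\le J}$, $\mathcal F_0$ being $\mathsf P$-trivial (so that $Y_0^\star$ below is deterministic); $\mathsf E_{\mathcal F_j}$ denotes conditional expectation given $\mathcal F_j$. The reward process $Z=(Z_j)_{0\le j\le J}$ is real-valued, adapted and integrable. The Snell envelope is $Y_j^{\star}=\operatorname{ess\,sup}_{\tau\in\mathcal T[j,\ldots,J]}\mathsf E_{\mathcal F_j}[Z_\tau]$, where $\mathcal T[j,\ldots,J]$ is the set of stopping times with values in $\{j,\ldots,J\}$. Its Doob decomposition is $Y_j^{\star}=Y_0^{\star}+M_j^{\star}-A_j^{\star}$ with $M^{\star}_j=\sum_{l=1}^{j}\left(Y_l^{\star}-\mathsf E_{\mathcal F_{l-1}}[Y_l^{\star}]\right)$ (the Doob martingale, $M_0^\star=0$) and $A_j^{\star}=\sum_{l=1}^{j}\left(Y_{l-1}^{\star}-\mathsf E_{\mathcal F_{l-1}}[Y_l^{\star}]\right)$ (predictable, non-decreasing). $\mathcal M^{\circ,0}$ is the set of martingales $M=(M_j)_{0\le j\le J}$ with respect to $(\mathcal F_j)$ with $M_0=0$ and $Y_0^{\star}=\mathsf E_{\mathcal F_0}\left[\max_{0\le r\le J}(Z_r-M_r)\right]$. $(\Omega_0,\mathcal B)$ is an auxiliary measurable space (rich enough to carry the randomization), $\widetilde\Omega=\Omega\times\Omega_0$, $\widetilde{\mathcal F}=\sigma\{F\times B:F\in\mathcal F,B\in\mathcal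 B\}$, and $\widetilde{\mathsf P}$ is a probability measure on $(\widetilde\Omega,\widetilde{\mathcal F})$ extending $\mathsf P$, i.e. $\widetilde{\mathsf P}(F\times\Omega_0)=\mathsf P(F)$ for all $F\in\mathcal F$; $\widetilde{\mathsf E}$ is its expectation. $\mathcal F$ and $\mathcal F_j$ are identified with $\{F\times\Omega_0:F\in\mathcal F\}$ and $\{F\times\Omega_0:F\in\mathcal F_j\}$, and random variables on $\Omega$ are regarded as random variables on $\widetilde\Omega$ not depending on $\omega_0\in\Omega_0$. *)

(* Defs.v *)
From HB Require Import structures.
From mathcomp Require Import all_boot all_order all_algebra.
From mathcomp Require Import all_classical all_reals all_analysis.
Import Order.TTheory GRing.Theory Num.Theory numFieldNormedType.Exports.

Set Implicit Arguments.
Unset Strict Implicit.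
Unset Printing Implicit Defensive.

Local Open Scope classical_set_scope.
Local Open Scope ring_scope.

(* Processes indexed by 0 <= j <= J are families [nat -> T -> R]; only the
   indices j <= J are ever constrained or used. *)

Section Probability.
Context (d : measure_display) (T : measurableType d) (R : realType).
Variable P : probability T R.

Definition wrt_measurable (G : set (set T)) (X : T -> R) : Prop :=
  preimage_set_system setT X measurable `<=` G.

Definition is_cond_exp (G : set (set T)) (X W : T -> R) : Prop :=
  [/\ wrt_measurable G W,
      P.-integrable setT (EFin \o W) &
      forall A, G A -> (\int[P]_(w in A) (W w)%:E = \int[P]_(w in A) (X w)%:E)%E].

(* A chosen version.  It exists by Radon-Nikodym when [X] is integrable and [G]
   is a sub-sigma-algebra; the default value 0 is irrelevant in that case. *)
Definition cond_exp (G : set (set T)) (X : T -> R) : T -> R :=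
  xget (fun=> 0) [set W | is_cond_exp G X W].

(* Essential supremum of a family of random variables in the probability space
   (T, G, P): the P-a.s. smallest G-measurable P-a.s. upper bound.  This is the
   real-valued notion, adequate for families whose essential supremum is a.s.
   finite (as for the Snell envelope of an integrable process).
   [mathcomp.analysis.ess_sup] is instead the essential bound (a constant) of a
   single function. *)
Definition is_esssup (G : set (set T)) (Phi : set (T -> R)) (Y : T -> R) : Prop :=
  [/\ wrt_measurable G Y,
      forall X, Phi X -> \forall w \ae P, X w <= Y w &
      forall Y', wrt_measurable G Y' ->
        (forall X, Phi X -> \forall w \ae P, X w <= Y' w) ->
        \forall w \ae P, Y w <= Y' w].

Definition esssup (G : set (set T)) (Phi : set (T -> R)) : T -> R :=
  xget (fun=> 0) [set Y | is_esssup G Phi Y].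

Definition filtration (J : nat) (F : nat -> set (set T)) : Prop :=
  [/\ forall j, (j <= J)%N -> sigma_algebra setT (F j),
      forall j, (j <= J)%N -> F j `<=` measurable &
      forall i j, (i <= j <= J)%N -> F i `<=` F j].

Definition trivial_sigma_algebra (G : set (set T)) : Prop :=
  forall A, G A -> P A = 0%E \/ P A = 1%E.

Definition adapted (J : nat) (F : nat -> set (set T)) (X : nat -> T -> R) : Prop :=
  forall j, (j <= J)%N -> wrt_measurable (F j) (X j).

Definition integrable_process (J : nat) (X : nat -> T -> R) : Prop :=
  forall j, (j <= J)%N -> P.-integrable setT (EFin \o X j).

Definition martingale (J : nat) (F : nat -> set (set T)) (M : nat -> T -> R) : Prop :=
  [/\ adapted J F M, integrable_process J M &
      forall i j, (i <= j <= J)%N ->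
        \forall w \ae P, cond_exp (F i) (M j) w = M i w].

Definition stopping_times (J : nat) (F : nat -> set (set T)) (j : nat) :
    set (T -> nat) :=
  [set tau | (forall w, (j <= tau w <= J)%N) /\
             (forall i, (i <= J)%N -> F i [set w | (tau w <= i)%N])].

Definition snell (J : nat) (F : nat -> set (set T)) (Z : nat -> T -> R)
    (j : nat) : T -> R :=
  esssup (F j)
    [set cond_exp (F j) (fun w => Z (tau w) w) | tau in stopping_times J F j].

Definition doob_martingale (F : nat -> set (set T)) (Y : nat -> T -> R)
    (j : nat) (w : T) : R :=
  \sum_(1 <= l < j.+1) (Y l w - cond_exp (F l.-1) (Y l) w).

Definition doob_predictable (F : nat -> set (set T)) (Y : nat -> T -> R)
    (j : nat) (w : T) : R :=
  \sum_(1 <= l < j.+1) (Y l.-1 w - cond_exp (F l.-1) (Y l) w).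

(* The initial value [X ord0] of the iteration is one of the terms, hence
   redundant. *)
Definition max_process (U : Type) (J : nat) (X : 'I_J.+1 -> U -> R) (w : U) : R :=
  \big[Num.max/X ord0 w]_(j < J.+1) X j w.

Definition optimal_martingale (J : nat) (F : nat -> set (set T))
    (Z M : nat -> T -> R) : Prop :=
  [/\ martingale J F M,
      \forall w \ae P, M 0%N w = 0 &
      \forall w \ae P, snell J F Z 0%N w =
        cond_exp (F 0%N)
          (max_process (fun (j : 'I_J.+1) w' => Z j w' - M j w')) w].

Definition indep_set_systems (G H : set (set T)) : Prop :=
  forall A B, G A -> H B -> P (A `&` B) = (P A * P B)%E.

Definition mutually_independent (I : finType) (X : I -> {RV P >-> R}) : Prop :=
  forall (S : {set I}) (B : I -> set R), (forall i, measurable (B i)) ->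
    P (\bigcap_(i in [set i | i \in S]) (X i @^-1` B i)) =
    (\prod_(i in S) P (X i @^-1` B i))%E.

Definition identically_distributed (I : Type) (X : I -> {RV P >-> R}) : Prop :=
  forall i i' (B : set R), measurable B ->
    distribution P (X i) B = distribution P (X i') B.

Definition has_density (X : {RV P >-> R}) (p : R -> R) : Prop :=
  [/\ measurable_fun setT p, forall x, 0 <= p x &
      forall B : set R, measurable B ->
        distribution P X B = (\int[lebesgue_measure]_(x in B) (p x)%:E)%E].

End Probability.

(* Main.v *)
Require Import Defs.
From HB Require Import structures.
From mathcomp Require Import all_boot all_order all_algebra.
From mathcomp Require Import all_classical all_reals all_analysis.
From mathcomp Require Import measurable_realfun.
From mathcomp Require Import ring lra.
Import Order.TTheory GRing.Theory Num.Theory numFieldNormedType.Exports.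

Local Open Scope classical_set_scope.
Local Open Scope ring_scope.

(** Let [tau] be the first time the Snell envelope [Y] meets the reward [Z].  At
    [tau] both [Y - Z] and [A*] vanish, hence so does the perturbation [eta], and
    [L := Z_tau - M_tau] is one of the terms of the randomized maximum [W].  By
    optional stopping [E L = Y_0], whence [E W >= Y_0].  If equality holds, then
    [W = L] a.s., so that [Z_j - M_j + xi_j (Y_j - Z_j + A*_j) <= L] for every
    [j].  Since [xi_j] is independent of the first factor and charges every left
    neighbourhood of 1 (this is where [p 1 > 0] enters), [xi_j] may be replaced
    by 1, giving [Y_j + A*_j - M_j <= L].  Both sides have mean [Y_0], so they
    agree a.s.; as [Y + A* = Y_0 + M*], comparing [j] with [0] yields
    [M_j = M*_j] a.s. *)

(** * Real-valued integrals under almost-everywhere relations *)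

Section ae_integral.
Set Implicit Arguments.
Unset Strict Implicit.
Context d (T : measurableType d) (R : realType).
Variable mu : {measure set T -> \bar R}.
Implicit Types (f g : T -> R) (A B : set T).

Lemma integrable_measurable f : mu.-integrable setT (EFin \o f) ->
  measurable_fun setT f.
Proof. by move=> /measurable_int/measurable_EFinP. Qed.

Lemma ae_eq_Rintegral f g A : measurable A ->
  mu.-integrable setT (EFin \o f) -> mu.-integrable setT (EFin \o g) ->
  (\forall w \ae mu, f w = g w) -> \int[mu]_(w in A) f w = \int[mu]_(w in A) g w.
Proof.
move=> mA fi gi fg; rewrite /Rintegral; congr fine; apply: ae_eq_integral => //.
- by apply: measurable_funTS; exact: measurable_int fi.
- by apply: measurable_funTS; exact: measurable_int gi.
- by apply: filterS fg => w /= -> _.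
Qed.

Lemma integrable_max f g : mu.-integrable setT (EFin \o f) ->
  mu.-integrable setT (EFin \o g) ->
  mu.-integrable setT (EFin \o (fun w => Num.max (f w) (g w))).
Proof.
move=> fi gi.
apply: (@le_integrable _ _ _ _ _ measurableT _
  ((abse \o (EFin \o f)) \+ (abse \o (EFin \o g)))%E).
- apply/measurable_EFinP; apply: measurable_maxr; exact: integrable_measurable.
- move=> x _ /=; rewrite lee_fin [leRHS]ger0_norm ?addr_ge0//.
  rewrite /Num.max; case: ifP => _; first by rewrite lerDr.
  by rewrite lerDl.
- by apply: integrableD => //; exact: integrable_abse.
Qed.

(** Replacing [g] by the maximum of [f] and [g], which equals [g] a.e., turns the a.e. inequality
    into one valid everywhere. *)
Lemma ae_le_Rintegral f g A : measurable A ->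
  mu.-integrable setT (EFin \o f) -> mu.-integrable setT (EFin \o g) ->
  (\forall w \ae mu, f w <= g w) ->
  \int[mu]_(w in A) f w <= \int[mu]_(w in A) g w.
Proof.
move=> mA fi gi fg.
have mi := integrable_max fi gi.
rewrite (@ae_eq_Rintegral g (fun w => Num.max (f w) (g w)))//.
  apply: le_Rintegral => //.
  - exact: integrableS fi.
  - exact: integrableS mi.
  - by move=> x _; rewrite le_max lexx.
by apply: filterS fg => w fg; rewrite max_r.
Qed.

(** The difference [g - f] is a.e. nonnegative with integral at most 0, so its absolute value
    integrates to 0. This rigidity is what turns equal means into a.s. equality later on. *)
Lemma ae_le_eq_Rintegral f g :
  mu.-integrable setT (EFin \o f) -> mu.-integrable setT (EFin \o g) ->
  (\forall w \ae mu, f w <= g w) ->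
  \int[mu]_w g w <= \int[mu]_w f w -> \forall w \ae mu, f w = g w.
Proof.
move=> fi gi fg ifg.
have hi : mu.-integrable setT (EFin \o (fun w => g w - f w)).
  exact: (integrableB _ gi fi).
have hni := integrable_norm hi.
have : (\int[mu]_(x in setT) `|(EFin \o (fun w => (g w - f w)%R)) x| = 0)%E.
  rewrite -(fineK (integrable_fin_num _ hni))//; congr EFin.
  apply/eqP; rewrite eq_le; apply/andP; split; last first.
    by apply: Rintegral_ge0 => w _ /=.
  rewrite (_ : fine _ = \int[mu]_w (g w - f w)).
    by rewrite RintegralB// subr_le0.
  symmetry; apply: ae_eq_Rintegral => //.
  by apply: filterS fg => w fg /=; rewrite ger0_norm ?subr_ge0.
move=> h0; have := (ae_eq_integral_abs mu measurableT (measurable_int mu hi)).1 h0.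
by apply: filterS => w /= /(_ Logic.I) [] /eqP; rewrite subr_eq0 => /eqP ->.
Qed.

Lemma integrable_ae_eq f g : measurable_fun setT g ->
  mu.-integrable setT (EFin \o f) -> (\forall w \ae mu, f w = g w) ->
  mu.-integrable setT (EFin \o g).
Proof.
move=> mg /integrableP[mf foo] fg.
have meg : measurable_fun setT (EFin \o g) by exact/measurable_EFinP.
apply/integrableP; split; first exact/measurable_EFinP.
apply: le_lt_trans foo; rewrite le_eqVlt; apply/orP; left; apply/eqP.
apply: ae_eq_integral => //; [exact: measurableT_comp..|].
by apply: filterS fg => w /= ->.
Qed.

Lemma Rintegral_split f A B : measurable A -> measurable B ->
  mu.-integrable setT (EFin \o f) ->
  \int[mu]_(w in A) f w =
  \int[mu]_(w in A `&` B) f w + \int[mu]_(w in A `\` B) f w.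
Proof.
move=> mA mB fi; rewrite -Rintegral_setU.
- by rewrite setUIDK.
- exact: measurableI.
- exact: measurableD.
- by rewrite setUIDK; exact: integrableS fi.
- by apply/disj_setPS => x [[_ Bx] [_ nBx]].
Qed.

End ae_integral.

(** * Sub-sigma-algebras and existence of conditional expectations *)

Section sub_sigma_algebra.
Set Implicit Arguments.
Unset Strict Implicit.
Context d (T : measurableType d) (R : realType) (P : probability T R).
Variable G : set (set T).
Hypotheses (sG : sigma_algebra setT G) (Gm : G `<=` measurable).
Implicit Types (X Y W : T -> R) (A B : set T).

(** The space [T] with [G] as its measurable sets: through it, measurability with respect to [G]
    becomes ordinary [measurable_fun]. *)
Let TG := g_sigma_algebraType G.

Lemma g_sigma_measurableE A : (measurable : set (set TG)) A = G A.
Proof. by rewrite -[in RHS](measurable_g_measurableTypeE sG). Qed.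

Lemma wrt_measurableP X : wrt_measurable G X <-> measurable_fun (setT : set TG) X.
Proof.
split=> [GX _ B mB|mX _ [B mB] <-].
  by rewrite g_sigma_measurableE; apply: GX; exists B.
by rewrite -g_sigma_measurableE; exact: mX.
Qed.

Lemma wrt_measurable_measurable X : wrt_measurable G X -> measurable_fun setT X.
Proof. by move=> GX _ B mB; apply/Gm/GX; exists B. Qed.

Lemma wrt_measurable_cst (r : R) : wrt_measurable G (cst r : T -> R).
Proof. by apply/wrt_measurableP; exact: measurable_cst. Qed.

Lemma wrt_measurable_max X Y : wrt_measurable G X -> wrt_measurable G Y ->
  wrt_measurable G (fun w => Num.max (X w) (Y w)).
Proof.
by move=> /wrt_measurableP mX /wrt_measurableP mY; apply/wrt_measurableP;
  exact: measurable_maxr.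
Qed.

Lemma wrt_measurable_le X Y : wrt_measurable G X -> wrt_measurable G Y ->
  G [set w | X w <= Y w].
Proof.
move=> /wrt_measurableP mX /wrt_measurableP mY; rewrite -g_sigma_measurableE.
rewrite (_ : [set w | _] = setT `&` (fun w : TG => X w <= Y w) @^-1` [set true]).
  exact: measurable_fun_ler.
by rewrite setTI.
Qed.

Lemma sub_sigma_algebraI A B : G A -> G B -> G (A `&` B).
Proof. by rewrite -!g_sigma_measurableE => GA GB; exact: measurableI. Qed.

Lemma sub_sigma_algebraD A B : G A -> G B -> G (A `\` B).
Proof. by rewrite -!g_sigma_measurableE => GA GB; exact: measurableD. Qed.

Lemma sub_sigma_algebraU A B : G A -> G B -> G (A `|` B).
Proof. by rewrite -!g_sigma_measurableE => GA GB; exact: measurableU. Qed.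

Lemma sub_sigma_algebra0 : G set0.
Proof. by rewrite -g_sigma_measurableE; exact: measurable0. Qed.

Lemma sub_sigma_algebraT : G setT.
Proof. by rewrite -g_sigma_measurableE; exact: measurableT. Qed.

(** The hypothesis is tested on the event [A] where [Y < X]. The maximum of [X] and [Y] is [X] on
    [A] and [Y] off it, so its integral is at most that of [Y]; as it dominates [Y], the two agree
    a.s. *)
Lemma le_ae_of_Rintegral X Y : wrt_measurable G X -> wrt_measurable G Y ->
  P.-integrable setT (EFin \o X) -> P.-integrable setT (EFin \o Y) ->
  (forall A, G A -> \int[P]_(w in A) X w <= \int[P]_(w in A) Y w) ->
  \forall w \ae P, X w <= Y w.
Proof.
move=> GX GY iX iY XY.
pose A := [set: T] `\` [set w | X w <= Y w].
have GA : G A.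
  apply: sub_sigma_algebraD; first exact: sub_sigma_algebraT.
  exact: wrt_measurable_le.
have mi := integrable_max iX iY.
suff : \forall w \ae P, Y w = Num.max (X w) (Y w).
  by apply: filterS => w ->; rewrite le_max lexx.
apply: ae_le_eq_Rintegral => //.
  by apply: aeW => w; rewrite le_max lexx orbT.
have mA := Gm GA.
rewrite (Rintegral_split measurableT mA mi) (Rintegral_split measurableT mA iY).
rewrite lerD//.
  rewrite !setTI (_ : \int[P]_(w in A) _ = \int[P]_(w in A) X w); last first.
    apply: eq_Rintegral => w /set_mem[_ /negP]; rewrite -ltNge => YX.
    by rewrite max_l// ltW.
  exact: XY.
rewrite (_ : \int[P]_(w in _) _ = \int[P]_(w in [set: T] `\` A) Y w)//.
apply: eq_Rintegral => w; rewrite inE => -[_ /not_andP[//|/contrapT XYw]].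
by rewrite max_r.
Qed.

Lemma eq_ae_of_Rintegral X Y : wrt_measurable G X -> wrt_measurable G Y ->
  P.-integrable setT (EFin \o X) -> P.-integrable setT (EFin \o Y) ->
  (forall A, G A -> \int[P]_(w in A) X w = \int[P]_(w in A) Y w) ->
  \forall w \ae P, X w = Y w.
Proof.
move=> GX GY iX iY XY.
have le1 : \forall w \ae P, X w <= Y w.
  by apply: le_ae_of_Rintegral => // A GA; rewrite XY.
have le2 : \forall w \ae P, Y w <= X w.
  by apply: le_ae_of_Rintegral => // A GA; rewrite XY.
by apply: filterS2 le1 le2 => w ? ?; apply/eqP; rewrite eq_le; apply/andP.
Qed.

(** Radon-Nikodym on [TG]: the charge sending [A] to the integral of [X] over [A] is dominated by
    [P] restricted to [G]. *)
Lemma cond_exp_exists X : P.-integrable setT (EFin \o X) ->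
  exists W, is_cond_exp P G X W.
Proof.
move=> iX.
have mid : measurable_fun [set: T] (id : T -> TG).
  by move=> _ B; rewrite g_sigma_measurableE => GB; rewrite setTI; exact: Gm.
(* Restriction to [G] is expressed as a pushforward along the identity from [T] to [TG], both for
   [P] (giving [m]) and for the charge of [X] (giving [nu]). *)
pose I : {mfun T >-> TG} :=
  MeasurableFun.Pack (MeasurableFun.Class (isMeasurableFun.Build _ _ _ _ _ mid)).
pose m : probability TG R := distribution P I.
have [nu nuE] : exists nu : {charge set TG -> \bar R},
    forall A, nu A = (\int[P]_(w in A) (X w)%:E)%E.
  unshelve eexists (pushforward (induced_charge iX) (id : T -> TG)); first exact: mid.
  by [].
have num : nu `<< m.
  apply/null_content_dominatesP => A mA mA0.
  rewrite nuE; apply: null_set_integral => //.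
  - by apply: Gm; rewrite -g_sigma_measurableE.
  - by apply: measurable_funTS; exact: measurable_int iX.
pose W := fine \o Radon_Nikodym nu m.
have iW := Radon_Nikodym_integrable num.
have EW : EFin \o W = Radon_Nikodym nu m.
  by apply/funext => w /=; rewrite fineK// Radon_Nikodym_fin_num.
have GW : measurable_fun (setT : set TG) W.
  by apply: (@measurableT_comp _ _ _ _ _ _ fine) => //; exact: measurable_int iW.
have iWP : P.-integrable setT (EFin \o W).
  apply/integrableP; split.
    exact/measurable_EFinP/wrt_measurable_measurable/wrt_measurableP.
  move/integrableP : iW => [mW]; rewrite -EW ge0_integral_distribution//.
  by apply: measurableT_comp => //; rewrite EW.
exists W; split => //; first exact/wrt_measurableP.
move=> A GA.
have mA : measurable (A : set TG) by rewrite g_sigma_measurableE.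
rewrite -nuE (Radon_Nikodym_integral num mA) -EW.
rewrite (integral_pushforward mid)//.
- exact/measurable_EFinP.
- by apply: integrableS iWP => //; exact: Gm.
Qed.

Lemma cond_expP X : P.-integrable setT (EFin \o X) ->
  is_cond_exp P G X (cond_exp P G X).
Proof. by move=> /cond_exp_exists; exact: xgetPex. Qed.

Lemma wrt_measurable_cond_exp X : P.-integrable setT (EFin \o X) ->
  wrt_measurable G (cond_exp P G X).
Proof. by move=> /cond_expP[]. Qed.

Lemma integrable_cond_exp X : P.-integrable setT (EFin \o X) ->
  P.-integrable setT (EFin \o cond_exp P G X).
Proof. by move=> /cond_expP[]. Qed.

Lemma Rintegral_cond_exp X A : P.-integrable setT (EFin \o X) -> G A ->
  \int[P]_(w in A) cond_exp P G X w = \int[P]_(w in A) X w.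
Proof. by move=> /cond_expP[_ _ WX] GA; rewrite /Rintegral WX. Qed.

End sub_sigma_algebra.

(** * Stopping times, stopped processes and optional stopping *)

Section stopping.
Set Implicit Arguments.
Unset Strict Implicit.
Context d (T : measurableType d) (R : realType) (P : probability T R).
Variables (J : nat) (F : nat -> set (set T)).
Hypothesis F_filt : filtration J F.
Implicit Types (X : nat -> T -> R) (tau : T -> nat) (A B : set T) (j : nat).

Let sF j : (j <= J)%N -> sigma_algebra setT (F j).
Proof. by case: F_filt => + _ _; exact. Qed.

Let mF j : (j <= J)%N -> F j `<=` measurable.
Proof. by case: F_filt => _ + _; exact. Qed.

Let subF i j : (i <= j <= J)%N -> F i `<=` F j.
Proof. by case: F_filt => _ _; exact. Qed.

Lemma stopping_times_eq j tau i : stopping_times J F j tau -> (i <= J)%N ->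
  F i [set w | tau w = i].
Proof.
move=> [_ Ftau] iJ.
(* The subtracted event is empty for [i = 0]; otherwise it belongs to the previous sigma-algebra,
   hence to [F i]. *)
rewrite (_ : [set w | tau w = i] =
  [set w | (tau w <= i)%N] `\` [set w | (tau w < i)%N]); last first.
  apply/seteqP; split => w /=; first by move=> ->; rewrite leqnn ltnn.
  by move=> [tau_le /negP]; rewrite -leqNgt => i_le; apply/eqP; rewrite eqn_leq tau_le.
apply: sub_sigma_algebraD; [exact: sF|exact: Ftau|].
case: i iJ => [_|i iJ].
  rewrite (_ : mkset _ = set0); first exact: (sub_sigma_algebra0 (sF _)).
  by apply/seteqP; split => // w /=; rewrite ltn0.
by apply: (@subF i); [rewrite leqnSn|apply: Ftau; exact: ltnW].
Qed.

Lemma stopping_times_cst j : (j <= J)%N -> stopping_times J F j (fun=> j).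
Proof.
move=> jJ; split=> [w|i iJ]; first by rewrite leqnn.
have [ji|ij] := leqP j i.
  rewrite (_ : mkset _ = setT); first exact: (sub_sigma_algebraT (sF _)).
  by apply/seteqP; split => // w _ /=.
rewrite (_ : mkset _ = set0); first exact: (sub_sigma_algebra0 (sF _)).
by apply/seteqP; split => // w /=; rewrite leqNgt ij.
Qed.

(** Exactly one summand is nonzero, the one at [tau w]. Integrability and integrals of stopped
    processes thus reduce to the levels of [tau]. *)
Lemma stoppedE j tau X w : stopping_times J F j tau ->
  (X (tau w) w)%:E =
  (\sum_(i < J.+1) ((EFin \o X i) \_ [set w | tau w = i]) w)%E.
Proof.
move=> [/(_ w)/andP[_ tauJ] _].
rewrite (bigD1 (Ordinal (tauJ : (tau w < J.+1)%N)))//= patchE mem_set//=.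
rewrite big1 ?adde0// => i /negP itau; rewrite patchE memNset//= => tauw.
by apply: itau; apply/eqP/val_inj.
Qed.

Let integrable_patch j tau X i : stopping_times J F j tau ->
  integrable_process P J X -> (i <= J)%N ->
  P.-integrable setT ((EFin \o X i) \_ [set w | tau w = i]).
Proof.
move=> stau iX iJ; have mA := mF iJ (stopping_times_eq stau iJ).
by apply: (integrable_mkcond (EFin \o X i) mA).1; exact: integrableS (iX _ iJ).
Qed.

Lemma integrable_stopped j tau X : stopping_times J F j tau ->
  integrable_process P J X ->
  P.-integrable setT (EFin \o (fun w => X (tau w) w)).
Proof.
move=> stau iX; rewrite (_ : EFin \o _ = fun w =>
  (\sum_(i < J.+1) ((EFin \o X i) \_ [set w | tau w = i]) w)%E); last first.
  by apply/funext => w; exact: stoppedE stau.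
by apply: integrable_sum => // i _; apply: (integrable_patch stau iX); rewrite -ltnS.
Qed.

Lemma Rintegral_stopped j tau X : stopping_times J F j tau ->
  integrable_process P J X ->
  \int[P]_w X (tau w) w =
  \sum_(i < J.+1) \int[P]_(w in [set w | tau w = i]) X i w.
Proof.
move=> stau iX; rewrite {1}/Rintegral; under eq_integral do rewrite (stoppedE _ _ stau).
rewrite integral_sum//=; last first.
  by move=> i; apply: (integrable_patch stau iX); rewrite -ltnS.
rewrite -sum_fine => [|i _].
  by apply: eq_bigr => i _; rewrite -integral_mkcond.
apply: integrable_fin_num => //.
by apply: (integrable_patch stau iX); rewrite -ltnS.
Qed.

Lemma Rintegral_martingale X i j A : martingale P J F X -> (i <= j <= J)%N ->
  F i A -> \int[P]_(w in A) X i w = \int[P]_(w in A) X j w.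
Proof.
move=> [aX iX mX] ijJ FA; have /andP[ij jJ] := ijJ; have iJ := leq_trans ij jJ.
rewrite -(Rintegral_cond_exp (sF iJ) (mF iJ) (iX _ jJ) FA).
apply: ae_eq_Rintegral; first exact: mF FA.
- exact: iX.
- by apply: integrable_cond_exp; [exact: sF|exact: mF|exact: iX].
- by apply: filterS (mX i j ijJ) => w ->.
Qed.

(** On the level where [tau] equals [i], an event of [F i], the integrals of [X i] and [X J] agree;
    summing over [i] gives the mean of [X J]. *)
Lemma optional_stopping X j tau : martingale P J F X -> stopping_times J F j tau ->
  \int[P]_w X (tau w) w = \int[P]_w X 0%N w.
Proof.
move=> mX stau; have [_ iX _] := mX.
rewrite (@Rintegral_martingale X 0 J)// ?leqnn//;
  last exact: (sub_sigma_algebraT (sF _)).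
rewrite (Rintegral_stopped stau iX).
(* The same level decomposition, applied to the process constantly equal to [X J] in time. *)
rewrite (@Rintegral_stopped _ tau (fun=> X J) stau); last first.
  by move=> i _; exact: iX.
apply: eq_bigr => i _; apply: Rintegral_martingale => //.
  by rewrite leqnn andbT -ltnS.
by apply: stopping_times_eq stau _; rewrite -ltnS.
Qed.

(** * Snell envelope by backward induction *)

Section snell_envelope.
Variable Z : nat -> T -> R.
Hypotheses (Z_adapted : adapted J F Z) (Z_int : integrable_process P J Z).
Notation Y := (snell P J F Z).

(** Optimality from time [j] on, tested against events of [F j]: [tau] attains [V] and no other
    stopping time does better. In this integrated form dynamic programming needs no essential
    supremum. *)
Definition optimal_value j (V : T -> R) tau :=
  [/\ stopping_times J F j tau, wrt_measurable (F j) V,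
      P.-integrable setT (EFin \o V),
      forall A, F j A ->
        \int[P]_(w in A) V w = \int[P]_(w in A) Z (tau w) w &
      forall sigma A, stopping_times J F j sigma -> F j A ->
        \int[P]_(w in A) Z (sigma w) w <= \int[P]_(w in A) V w].

(** [V] bounds the family and agrees a.s. with its member at [tau], so every other upper bound
    dominates it. *)
Lemma optimal_value_esssup j V tau : (j <= J)%N -> optimal_value j V tau ->
  is_esssup P (F j)
    [set cond_exp P (F j) (fun w => Z (tau w) w) | tau in stopping_times J F j] V.
Proof.
move=> jJ [stau FV iV Vtau Vle]; have [sFj mFj] := (sF jJ, mF jJ).
have iZ s : stopping_times J F j s -> P.-integrable setT (EFin \o (fun w => Z (s w) w)).
  by move=> ss; exact: integrable_stopped ss _.
split => // [_ [s ss <-]|Y' FY' ubY'].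
  apply: (le_ae_of_Rintegral sFj mFj) => //.
  - exact: wrt_measurable_cond_exp (iZ _ ss).
  - exact: integrable_cond_exp (iZ _ ss).
  - by move=> A FA; rewrite (Rintegral_cond_exp sFj mFj)//; [exact: Vle|exact: iZ].
have VE : \forall w \ae P, V w = cond_exp P (F j) (fun w => Z (tau w) w) w.
  apply: (eq_ae_of_Rintegral sFj mFj) => //.
  - exact: wrt_measurable_cond_exp (iZ _ stau).
  - exact: integrable_cond_exp (iZ _ stau).
  - by move=> A FA; rewrite (Rintegral_cond_exp sFj mFj)//; [exact: Vtau|exact: iZ].
have := ubY' _ (ex_intro2 _ _ tau stau erefl).
by apply: filterS2 VE => w ->.
Qed.

(** [V] witnesses that an essential supremum exists, so the choice defining [Y j] is not the default
    0. Two essential suprema bound each other, and [Y j] inherits optimality from [V]. *)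
Lemma optimal_value_snell j V tau : (j <= J)%N -> optimal_value j V tau ->
  optimal_value j (Y j) tau /\ \forall w \ae P, Y j w = V w.
Proof.
move=> jJ opt; have Vsup := optimal_value_esssup jJ opt.
have Ysup : is_esssup P (F j) [set cond_exp P (F j) (fun w => Z (tau w) w)
    | tau in stopping_times J F j] (Y j).
  exact: (xgetPex (fun=> 0) (ex_intro _ _ Vsup)).
have [[FV ubV lbV] [FY ubY lbY]] := (Vsup, Ysup).
have YV : \forall w \ae P, Y j w = V w.
  apply: filterS2 (lbV _ FY ubY) (lbY _ FV ubV) => w VY YV.
  by apply/eqP; rewrite eq_le YV.
case: opt => stau _ iV Vtau Vle.
have iY : P.-integrable setT (EFin \o Y j).
  apply: (integrable_ae_eq _ iV); first exact: (wrt_measurable_measurable (mF jJ) FY).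
  by apply: filterS YV => w ->.
have YVint A : F j A -> \int[P]_(w in A) Y j w = \int[P]_(w in A) V w.
  by move=> FA; apply: ae_eq_Rintegral => //; exact: mF FA.
split=> //; split => // [A FA|s A ss FA]; first by rewrite YVint// Vtau.
by rewrite YVint//; exact: Vle.
Qed.

Lemma optimal_value_last : optimal_value J (Z J) (fun=> J).
Proof.
split => //; [exact: stopping_times_cst|exact: Z_adapted|exact: Z_int|].
- move=> s A [sJ _] _; rewrite le_eqVlt (eq_Rintegral P (g := Z J)) ?eqxx// => w _.
  by congr (Z _ w); apply/eqP; rewrite eqn_leq andbC.
Qed.

(** Bellman step: stop at [j] when the reward is at least the continuation value, otherwise follow
    [tau]. *)
Lemma optimal_value_step j V tau : (j < J)%N -> optimal_value j.+1 V tau ->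
  optimal_value j (fun w => Num.max (Z j w) (cond_exp P (F j) V w))
    (fun w => if cond_exp P (F j) V w <= Z j w then j else tau w).
Proof.
move=> jJ [stau FV iV Vtau Vle]; have jJ' := ltnW jJ.
have [sFj mFj] := (sF jJ', mF jJ').
set C := cond_exp P (F j) V.
have FC : wrt_measurable (F j) C by exact: wrt_measurable_cond_exp.
have iC : P.-integrable setT (EFin \o C) by exact: integrable_cond_exp.
have FZ := Z_adapted jJ'; have iZ := Z_int jJ'.
have iW := integrable_max iZ iC.
pose B := [set w | C w <= Z j w].
have FB : F j B by exact: wrt_measurable_le.
have FjS A : F j A -> F j.+1 A by apply: subF; rewrite leqnSn.
have stau' : stopping_times J F j (fun w => if C w <= Z j w then j else tau w).
  split=> [w|i iJ].
    case: ifP => _; first by rewrite leqnn.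
    by case: stau => /(_ w)/andP[/ltnW -> ->].
  have [ji|ij] := leqP j i; last first.
    rewrite (_ : mkset _ = set0); first exact: (sub_sigma_algebra0 (sF _)).
    apply/seteqP; split => // w /=; case: ifP => _; first by rewrite leqNgt ij.
    by case: stau => /(_ w)/andP[jt _] _ ti; move: (leq_trans jt ti); rewrite ltnNge ltnW.
  rewrite (_ : mkset _ = B `|` [set w | (tau w <= i)%N]).
    apply: sub_sigma_algebraU; [exact: sF| |by case: stau => _; exact].
    by apply: subF FB; rewrite ji.
  apply/seteqP; split => w; rewrite /B /=; case: ifP => //; first by left.
  - by right.
  - by move=> _ [].
(* Off [B] the maximum is [C], which integrates like [V] there because [A] minus [B] lies in
   [F j]. *)
have Wsplit A : F j A -> \int[P]_(w in A) Num.max (Z j w) (C w) =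
    \int[P]_(w in A `&` B) Z j w + \int[P]_(w in A `\` B) V w.
  move=> FA; rewrite (Rintegral_split (mFj _ FA) (mFj _ FB) iW); congr +%R.
    by apply: eq_Rintegral => w /set_mem[_ BC]; rewrite max_l.
  rewrite -(Rintegral_cond_exp sFj mFj iV); last exact: sub_sigma_algebraD.
  apply: eq_Rintegral => w /set_mem[_ /negP]; rewrite -ltNge => /ltW ZC.
  by rewrite max_r.
split => //.
- exact: wrt_measurable_max.
- move=> A FA; have iZtau := integrable_stopped stau' Z_int.
  rewrite Wsplit// (Rintegral_split (mFj _ FA) (mFj _ FB) iZtau); congr +%R.
    by apply: eq_Rintegral => w /set_mem[_ Bw]; rewrite ifT.
  rewrite Vtau; last exact: FjS (sub_sigma_algebraD sFj FA FB).
  by apply: eq_Rintegral => w /set_mem[_ /negP Bw]; rewrite ifN.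
- move=> s A ss FA; have iZs := integrable_stopped ss Z_int.
  have FD : F j [set w | s w = j] by exact: stopping_times_eq ss _.
  set D := [set w | s w = j] in FD.
  (* A competitor [s] earns [Z j] on [D]. Off [D] it is at least [j.+1], so it coincides with this
     truncation, to which the bound for [V] applies. *)
  have ss' : stopping_times J F j.+1 (fun w => maxn j.+1 (s w)).
    case: ss => sJ Fs; split=> [w|i iJ].
      by rewrite leq_maxl geq_max jJ; case/andP: (sJ w).
    have [ij|ji] := leqP i j.
      rewrite (_ : mkset _ = set0); first exact: (sub_sigma_algebra0 (sF _)).
      by apply/seteqP; split => // w /=; rewrite geq_max => /andP[]; rewrite ltnNge ij.
    rewrite (_ : mkset _ = [set w | (s w <= i)%N]); first exact: Fs.
    by apply/seteqP; split => w /=; rewrite geq_max ji.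
  rewrite (Rintegral_split (mFj _ FA) (mFj _ FD) iZs).
  rewrite (Rintegral_split (mFj _ FA) (mFj _ FD) iW).
  have FAD : F j (A `\` D) by exact: sub_sigma_algebraD.
  have FAiD : F j (A `&` D) by exact: sub_sigma_algebraI.
  apply: lerD.
    rewrite (eq_Rintegral P (g := Z j)) => [|w /set_mem[_ /= ->]//].
    apply: le_Rintegral; [exact: mFj|apply: integrableS iZ => //; exact: mFj
      |apply: integrableS iW => //; exact: mFj|].
    by move=> w _; rewrite le_max lexx.
  rewrite (eq_Rintegral P (g := fun w => Z (maxn j.+1 (s w)) w)); last first.
    move=> w /set_mem[_ sj]; rewrite (maxn_idPr _)// ltn_neqAle eq_sym.
    by case: ss => /(_ w)/andP[-> _] _; rewrite andbT; apply/eqP.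
  apply: (le_trans (Vle _ _ ss' (FjS _ FAD))).
  rewrite -(Rintegral_cond_exp sFj mFj iV)//.
  apply: le_Rintegral; [exact: mFj|apply: integrableS iC => //; exact: mFj
    |apply: integrableS iW => //; exact: mFj|].
  by move=> w _; rewrite le_max lexx orbT.
Qed.

(** Besides optimality, the induction records that [Y] meets [Z] at [tau] and has no drift before
    it; the latter makes the predictable part vanish at [tau]. *)
Lemma snell_optimal j : (j <= J)%N -> exists tau, optimal_value j (Y j) tau /\
  \forall w \ae P, Y (tau w) w = Z (tau w) w /\
    forall l, (j <= l < tau w)%N -> Y l w = cond_exp P (F l) (Y l.+1) w.
Proof.
(* Writing [j] as [J - k] lets induction on [k] run backward from the horizon. *)
move=> jJ; rewrite -(subKn jJ); elim: (J - j)%N (leq_subr j J) => [|k IH] kJ.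
  rewrite subn0; exists (fun=> J).
  have [opt YJ] := optimal_value_snell (leqnn J) optimal_value_last; split=> //.
  apply: filterS YJ => w ->; split => // l; rewrite ltnNge.
  by case: leqP.
have [tau [opt tauP]] := IH (ltnW kJ).
have k1J : ((J - k.+1).+1 = J - k)%N by rewrite subnSK.
set i := (J - k.+1)%N in k1J *; rewrite -k1J in opt tauP.
have iJ : (i < J)%N by rewrite k1J leq_subr.
have [opt' YE] := optimal_value_snell (ltnW iJ) (optimal_value_step iJ opt).
eexists; split; first exact: opt'.
apply: filterS2 YE tauP => w YE [tauZ tauC]; case: ifP => CZ.
  split; first by rewrite YE max_l.
  by move=> l /andP[il li]; move: (leq_ltn_trans il li); rewrite ltnn.
split => // l /andP[]; rewrite leq_eqVlt => /predU1P[<- _|il lt].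
  by rewrite YE max_r//; apply/ltW; rewrite ltNge CZ.
by apply: tauC; rewrite il.
Qed.

Lemma snell_ge_reward j : (j <= J)%N -> \forall w \ae P, Z j w <= Y j w.
Proof.
move=> jJ; have [tau [[_ FY iY _ Yle] _]] := snell_optimal jJ.
apply: (le_ae_of_Rintegral (sF jJ) (mF jJ)) => //; [exact: Z_adapted|exact: Z_int|].
by move=> A FA; apply: (Yle (fun=> j)) => //; exact: stopping_times_cst.
Qed.

Lemma adapted_snell : adapted J F Y.
Proof. by move=> j jJ; have [tau [[]]] := snell_optimal jJ. Qed.

Lemma integrable_snell : integrable_process P J Y.
Proof. by move=> j jJ; have [tau [[]]] := snell_optimal jJ. Qed.

(** A stopping time optimal from [j.+1] on is still admissible from [j] on. *)
Lemma snell_supermartingale j : (j < J)%N ->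
  \forall w \ae P, cond_exp P (F j) (Y j.+1) w <= Y j w.
Proof.
move=> jJ; have jJ' := ltnW jJ; have [sFj mFj] := (sF jJ', mF jJ').
have [_ [[_ FY iY _ Yle] _]] := snell_optimal jJ'.
have [tau [[[tau_ge Ftau] FY1 iY1 Ytau _] _]] := snell_optimal jJ.
apply: (le_ae_of_Rintegral sFj mFj) => //.
- exact: wrt_measurable_cond_exp.
- exact: integrable_cond_exp.
move=> A FA; rewrite (Rintegral_cond_exp sFj mFj)// Ytau; last first.
  by apply: subF FA; rewrite leqnSn.
apply: Yle => //; split => // w; by case/andP: (tau_ge w) => /ltnW -> ->.
Qed.

End snell_envelope.
End stopping.

(** * Doob decomposition of the Snell envelope *)

Section doob.
Set Implicit Arguments.
Unset Strict Implicit.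
Context d (T : measurableType d) (R : realType) (P : probability T R).
Variables (J : nat) (F : nat -> set (set T)) (Z : nat -> T -> R).
Hypotheses (F_filt : filtration J F) (Z_adapted : adapted J F Z).
Hypothesis Z_int : integrable_process P J Z.
Notation Y := (snell P J F Z).
Notation A := (doob_predictable P F Y).

(** The conditional expectations cancel and the rest telescopes, so the identity holds at every
    point and for every process. *)
Lemma doob_martingaleE (X : nat -> T -> R) j w :
  X j w + doob_predictable P F X j w = X 0%N w + doob_martingale P F X j w.
Proof.
rewrite /doob_predictable /doob_martingale; elim: j => [|j IH].
  by rewrite !big_geq.
rewrite !(big_nat_recr j.+1)//=; move: IH.
set a := \sum_(1 <= i < j.+1) _; set b := \sum_(1 <= i < j.+1) _ => IH.
have -> : b = X j w + a - X 0%N w by rewrite IH; ring.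
by ring.
Qed.

Lemma ae_snell_supermartingale : \forall w \ae P, forall l, (l < J)%N ->
  cond_exp P (F l) (Y l.+1) w <= Y l w.
Proof.
apply: ae_foralln => l; have [lJ|lJ] := ltnP l J; last by apply: aeW => w.
by apply: filterS (snell_supermartingale F_filt Z_adapted Z_int lJ).
Qed.

Lemma doob_predictable_ge0 j : (j <= J)%N -> \forall w \ae P, 0 <= A j w.
Proof.
move=> jJ; apply: filterS ae_snell_supermartingale => w super.
rewrite /doob_predictable big_nat; apply: sumr_ge0 => -[//|l] /= lj.
by rewrite subr_ge0; apply: super; exact: (leq_trans (lj : (l < j)%N) jJ).
Qed.

Lemma doob_gap_ge0 j : (j <= J)%N -> \forall w \ae P, 0 <= Y j w - Z j w + A j w.
Proof.
move=> jJ; apply: filterS2 (doob_predictable_ge0 jJ)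
  (snell_ge_reward F_filt Z_adapted Z_int jJ) => w A0 ZY.
by rewrite addr_ge0// subr_ge0.
Qed.

(** Each increment of the sum is [Y j.+1] minus its conditional expectation, which has mean zero. *)
Lemma snell_add_predictable j : (j <= J)%N ->
  P.-integrable setT (EFin \o (fun w => Y j w + A j w)) /\
  \int[P]_w (Y j w + A j w) = \int[P]_w Y 0%N w.
Proof.
have iY := integrable_snell F_filt Z_adapted Z_int.
elim: j => [|j IH] jJ.
  have -> : (fun w => Y 0%N w + A 0%N w) = Y 0%N.
    by apply/funext => w; rewrite /doob_predictable big_geq// addr0.
  by split; first exact: iY.
have [iS <-] := IH (ltnW jJ).
have [sF mF _] := F_filt.
have sFj := sF j (ltnW jJ); have mFj := mF j (ltnW jJ).
have iC := integrable_cond_exp sFj mFj (iY _ jJ).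
have iI := integrableB measurableT (iY _ jJ) iC.
have -> : (fun w => Y j.+1 w + A j.+1 w) =
    fun w => (Y j w + A j w) + (Y j.+1 w - cond_exp P (F j) (Y j.+1) w).
  by apply/funext => w; rewrite /doob_predictable big_nat_recr//=; ring.
split; first exact: (integrableD measurableT iS iI).
rewrite RintegralD// RintegralB//; last exact: iY.
by rewrite (Rintegral_cond_exp sFj mFj (iY _ jJ) (sub_sigma_algebraT sFj)) subrr addr0.
Qed.

(** At the optimal time the factor multiplying [xi] in the perturbation is zero, so randomization
    leaves that term unchanged. *)
Lemma snell_optimal_gap : exists tau, [/\ stopping_times J F 0 tau,
  \int[P]_w Z (tau w) w = \int[P]_w Y 0%N w &
  \forall w \ae P, Y (tau w) w - Z (tau w) w + A (tau w) w = 0].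
Proof.
have [tau [[stau _ _ Ytau _] tauP]] := snell_optimal F_filt Z_adapted Z_int (leq0n J).
exists tau; split => //.
  by rewrite Ytau//; apply: sub_sigma_algebraT; case: F_filt => + _ _; exact.
apply: filterS tauP => w [-> tauC]; rewrite subrr add0r /doob_predictable.
rewrite big_nat big1 // => -[//|l] /= lt.
by rewrite -tauC ?subrr.
Qed.

(** [Y 0] and its mean have equal integrals over every event of probability 0 or 1. *)
Lemma trivial_snell0 : trivial_sigma_algebra P (F 0%N) ->
  \forall w \ae P, Y 0%N w = \int[P]_w Y 0%N w.
Proof.
move=> F0; have [sF mF _] := F_filt.
have [sF0 mF0] := (sF 0 (leq0n J), mF 0 (leq0n J)).
have iY := integrable_snell F_filt Z_adapted Z_int (leq0n J).
have null B : F 0%N B -> P B = 0%E -> \int[P]_(w in B) Y 0%N w = 0.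
  move=> /mF0 mB PB0; rewrite /Rintegral null_set_integral//.
  by apply: measurable_funTS; exact: measurable_int iY.
apply: (eq_ae_of_Rintegral sF0 mF0) => //.
- exact: adapted_snell.
- exact: wrt_measurable_cst.
- exact: finite_measure_integrable_cst.
move=> B FB; rewrite Rintegral_cst; last exact: mF0.
have [PB|PB] := F0 _ FB; rewrite (congr1 fine PB) /=; first by rewrite null// mulr0.
have FTB : F 0%N ([set: T] `\` B).
  by apply: sub_sigma_algebraD => //; exact: sub_sigma_algebraT.
rewrite mulr1 (Rintegral_split measurableT (mF0 _ FB) iY) setTI.
rewrite (null _ FTB) ?addr0// setTD probability_setC ?PB ?subee//.
exact: mF0.
Qed.

End doob.

(** * Transfer between [P] and an extension [Pt] with first marginal [P] *)

Section product_extension.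
Set Implicit Arguments.
Unset Strict Implicit.
Context d (T : measurableType d) d0 (T0 : measurableType d0) (R : realType).
Variables (P : probability T R) (Pt : probability (T * T0)%type R).
Hypothesis Pt_ext : forall B : set T, measurable B -> Pt (B `*` setT) = P B.

Lemma ae_fst (Q : T -> Prop) : (\forall w \ae P, Q w) -> \forall w \ae Pt, Q w.1.
Proof.
move=> [N [mN PN QN]]; exists (N `*` setT); split.
- exact: measurableX.
- by rewrite Pt_ext.
- by move=> w nQ; split => //; exact: QN.
Qed.

Let PtE B : measurable B -> pushforward Pt fst B = P B.
Proof.
move=> mB; rewrite /pushforward -(Pt_ext mB); congr (Pt _).
by apply/seteqP; split => w //= [].
Qed.

Lemma integrable_fst (f : T -> R) : P.-integrable setT (EFin \o f) ->
  Pt.-integrable setT (EFin \o (f \o fst)).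
Proof.
move=> /integrableP[mf foo]; apply/integrableP; split.
  exact: (measurableT_comp mf measurable_fst).
suff <- : (\int[P]_x `|(EFin \o f) x| = \int[Pt]_x `|(EFin \o (f \o fst)) x|)%E by [].
transitivity (\int[pushforward Pt fst]_x (abse \o (EFin \o f)) x)%E.
  by apply: eq_measure_integral => B mB _; exact: esym (PtE mB).
rewrite (ge0_integral_pushforward (@measurable_fst _ _ T T0) Pt)//.
  exact: measurableT_comp.
by move=> x _; exact: abse_ge0.
Qed.

Lemma Rintegral_fst (f : T -> R) : P.-integrable setT (EFin \o f) ->
  \int[Pt]_w f w.1 = \int[P]_w f w.
Proof.
move=> fi; have ifst := integrable_fst fi; rewrite /Rintegral; congr fine.
transitivity (\int[pushforward Pt fst]_w (f w)%:E)%E.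
  rewrite (integral_pushforward (@measurable_fst _ _ T T0) (f := EFin \o f))//.
  exact: measurable_int fi.
by apply: eq_measure_integral => B mB _; exact: PtE.
Qed.

(* Independence lets [xi] be pushed to its essential supremum 1 on any event of
   the first factor. *)
Lemma ae_le_of_randomized (xi : T * T0 -> R) (a D L : T -> R) :
  measurable_fun setT xi ->
  (forall B C, measurable B -> measurable C ->
    Pt (xi @^-1` B `&` (C `*` setT)) = (Pt (xi @^-1` B) * Pt (C `*` setT))%E) ->
  (forall e, 0 < e -> (0 < Pt (xi @^-1` `](1 - e)%R, +oo[))%E) ->
  measurable_fun setT a -> measurable_fun setT D -> measurable_fun setT L ->
  (\forall w \ae P, 0 <= D w) ->
  (\forall w \ae Pt, a w.1 + xi w * D w.1 <= L w.1) ->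
  \forall w \ae P, a w + D w <= L w.
Proof.
move=> mxi ind pos ma mD mL D0 xiL.
(* The value 1 is approached from below, as [xi] need not attain it with positive probability. *)
have step n : \forall w \ae P, 0 <= D w -> a w + (1 - n.+1%:R^-1) * D w <= L w.
  pose C := [set w | 0 <= D w] `&` [set w | L w < a w + (1 - n.+1%:R^-1) * D w].
  have mC : measurable C.
    apply: measurableI.
      rewrite -[X in measurable X]setTI.
      exact: (measurable_fun_ler (f := cst 0) (g := D)).
    rewrite -[X in measurable X]setTI.
    apply: (measurable_fun_ltr (f := L) (g := fun w => a w + (1 - n.+1%:R^-1) * D w)) => //.
    apply: measurable_funD => //; exact: measurable_funM.
  exists C; split => //; last first.
    by move=> w /= /not_implyP[Dw /negP]; rewrite -ltNge.
  have e0 : (0 : R) < n.+1%:R^-1 by rewrite invr_gt0.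
  pose B : set R := `](1 - n.+1%:R^-1)%R, +oo[%classic.
  have mB : measurable B by exact: measurable_itv.
  (* On this event [xi * D] is at least the scaled [D], so the assumed bound fails. The event is
     null; by independence its probability factors, and the factor of [xi] is positive, so [C] is
     null. *)
  have : Pt (xi @^-1` B `&` (C `*` setT)) = 0%E.
    apply: measure_negligible.
      apply: measurableI; last exact: measurableX.
      by rewrite -[X in measurable X]setTI; exact: mxi.
    apply: negligibleS xiL => w []; rewrite /B /= in_itv/= andbT => xiw [[Dw Lw] _] /=.
    apply/negP; rewrite -ltNge; apply: (lt_le_trans Lw); rewrite lerD2l.
    by apply: ler_wpM2r => //; exact: ltW.
  rewrite ind// Pt_ext// => /eqP; rewrite mule_eq0 => /orP[/eqP PB0|/eqP//].
  by have := pos _ e0; rewrite -/B PB0 ltxx.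
apply: filterS2 (ae_foralln step) D0 => w stepw Dw.
rewrite leNgt; apply/negP => Lw.
have c0 : 0 < a w + D w - L w by rewrite subr_gt0.
(* This [n] exceeds [D] divided by the supposed excess, so the loss [D / n.+1] is smaller than the
   excess. *)
have := stepw (Num.bound (D w / (a w + D w - L w))) Dw.
have := archi_boundP (divr_ge0 Dw (ltW c0)).
set n := Num.bound _; rewrite ltr_pdivrMr// => Dn.
have n0 : (0 : R) < n.+1%:R by [].
rewrite leNgt => /negP; apply.
have : D w / n.+1%:R < a w + D w - L w.
  rewrite ltr_pdivrMr// mulrC; apply: lt_le_trans Dn _.
  by rewrite ler_wpM2r// ?ler_nat// ltW.
by rewrite mulrBl mul1r [_^-1 * _]mulrC; set q := D w / _ => qc; lra.
Qed.

End product_extension.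

(** * Mass of the noise near 1, and integrability of the randomized maximum *)

Section randomization.
Set Implicit Arguments.
Unset Strict Implicit.
Context d (T : measurableType d) (R : realType) (P : probability T R).

(** Left continuity at 1 keeps [p] above half of [p 1] on some interval ending at 1, which therefore
    carries positive mass. *)
Lemma density_pos (X : {RV P >-> R}) (p : R -> R) (e : R) : has_density X p ->
  {within [set x : R | x <= 1], continuous p} -> 0 < p 1 -> 0 < e ->
  (0 < P (X @^-1` `](1 - e)%R, +oo[))%E.
Proof.
move=> [mp p0 Xp] pc p1 e0.
have pn : \forall x \near within [set x : R | x <= 1] (nbhs (1 : R)), p 1 / 2 < p x.
  have /subspace_continuousP/(_ 1 (lexx _)) := pc.
  by move/cvgr_gt; apply; rewrite /from_subspace; lra.
move: pn; rewrite near_withinE => -[r /= r0 pr].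
(* Halving makes [k] strictly smaller than both the continuity radius [r] and [e]. *)
pose k := Num.min r e / 2.
have k0 : 0 < k by rewrite divr_gt0// lt_min r0.
have [kr ke] : k < r /\ k < e.
  have : Num.min r e <= r by rewrite ge_min lexx.
  have : Num.min r e <= e by rewrite ge_min lexx orbT.
  by rewrite /k; split; lra.
have -> : P (X @^-1` `](1 - e)%R, +oo[) = distribution P X `]1 - e, +oo[ by [].
rewrite Xp; last exact: measurable_itv.
apply: (@lt_le_trans _ _ (\int[lebesgue_measure]_(x in `[(1 - k)%R, 1%R]) cst (p 1 / 2)%:E x)%E).
  rewrite integral_cst; last exact: measurable_itv.
  rewrite /= lebesgue_measure_itv /= lte_fin ifT; last lra.
  rewrite -EFinB -EFinM lte_fin; apply: mulr_gt0; lra.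
apply: (@le_trans _ _ (\int[lebesgue_measure]_(x in `[(1 - k)%R, 1%R]) (p x)%:E)%E).
  apply: ge0_le_integral => //=.
  - by move=> x _; rewrite lee_fin; lra.
  - by apply/measurable_EFinP; exact: measurable_funTS.
  - move=> x; rewrite in_itv/= => /andP[kx x1]; rewrite lee_fin ltW//.
    by apply: pr => //=; rewrite ger0_norm; lra.
apply: ge0_subset_integral => //=.
- by apply/measurable_EFinP; exact: measurable_funTS.
- by move=> x _; rewrite lee_fin.
- by move=> x /=; rewrite !in_itv/= andbT => /andP[kx _]; lra.
Qed.

Lemma measurable_max_process n (X : 'I_n.+1 -> T -> R) :
  (forall j, measurable_fun setT (X j)) -> measurable_fun setT (max_process X).
Proof.
move=> mX.
have big_meas s :
    measurable_fun setT (fun w => \big[Num.max/X ord0 w]_(j <- s) X j w).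
  elim: s => [|j s IH].
    by rewrite (_ : (fun _ => _) = X ord0)//; apply/funext => w; rewrite big_nil.
  rewrite (_ : (fun _ => _) =
      X j \max (fun w => \big[Num.max/X ord0 w]_(k <- s) X k w)).
    exact: measurable_maxr.
  by apply/funext => w; rewrite big_cons.
exact: (big_meas (index_enum _)).
Qed.

Lemma integrable_between (L U f : T -> R) : measurable_fun setT f ->
  P.-integrable setT (EFin \o L) -> P.-integrable setT (EFin \o U) ->
  (\forall w \ae P, L w <= f w) -> (\forall w \ae P, f w <= U w) ->
  P.-integrable setT (EFin \o f).
Proof.
move=> mf iL iU Lf fU.
(* Clipping [f] between [L] and [U] changes it only on a null set, and the result is bounded
   everywhere by the sum of the absolute values of [L] and [U]. *)
pose g w := Num.max (L w) (Num.min (U w) (f w)).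
have mg : measurable_fun setT g.
  apply: measurable_maxr; first exact: integrable_measurable iL.
  by apply: measurable_minr => //; exact: integrable_measurable iU.
apply: (@integrable_ae_eq _ _ _ _ g) => //.
  apply: (@le_integrable _ _ _ _ _ measurableT _
    ((abse \o (EFin \o L)) \+ (abse \o (EFin \o U)))%E).
  - exact/measurable_EFinP.
  - move=> x _ /=; rewrite lee_fin [leRHS]ger0_norm ?addr_ge0// ler_norml.
    have l1 := ler_norm (L x); have l2 := ler_norm (U x).
    have l3 := ler_norm (- L x); rewrite normrN in l3.
    have gL : L x <= g x by rewrite /g le_max lexx.
    have gU : g x <= Num.max (L x) (U x) by rewrite /g ge_max le_max lexx le_max !ge_min lexx !orbT.
    have n1 := normr_ge0 (L x); have n2 := normr_ge0 (U x).
    have : Num.max (L x) (U x) <= `|L x| + `|U x| by rewrite ge_max; apply/andP; split; lra.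
    by move=> ?; apply/andP; split; lra.
  - by apply: integrableD => //; exact: integrable_abse.
by apply: filterS2 Lf fU => w Lf fU; rewrite /g min_r// max_r.
Qed.

End randomization.

(** * Lower bound and strictness for the randomized dual value *)

Theorem theorem3p2 (R : realType) (J : nat) (J_gt0 : (0 < J)%N)
  (d : measure_display) (T : measurableType d) (P : probability T R)
  (F : nat -> set (set T)) (F_filt : filtration J F)
  (F0_trivial : trivial_sigma_algebra P (F 0%N))
  (Z : nat -> T -> R) (Z_adapted : adapted J F Z)
  (Z_int : integrable_process P J Z)
  (M : nat -> T -> R) (M_opt : optimal_martingale P J F Z M)
  (d0 : measure_display) (T0 : measurableType d0)
  (Pt : probability (T * T0)%type R)
  (Pt_ext : forall A : set T, measurable A -> Pt (A `*` setT) = P A)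
  (xi : 'I_J.+1 -> {RV Pt >-> R})
  (xi_indep : mutually_independent xi)
  (xi_id : identically_distributed xi)
  (xi_indep_F : indep_set_systems Pt
     (g_sigma_preimage (fun j => xi j : T * T0 -> R))
     [set A `*` setT | A in (measurable : set (set T))])
  (xi_le1 : forall j w, xi j w <= 1)
  (xi_mean0 : forall j, ('E_Pt[xi j] = 0)%E)
  (p : R -> R) (xi_density : forall j, has_density (xi j) p)
  (p_support : forall x, 1 < x -> p x = 0)
  (p_cont : {within [set x : R | x <= 1], continuous p})
  (p1_gt0 : 0 < p 1) :
  let Y := snell P J F Z in
  let Mstar := doob_martingale P F Y in
  let Astar := doob_predictable P F Y in
  let eta := fun (j : 'I_J.+1) (w : T * T0) =>
    xi j w * (Y j w.1 - Z j w.1 + Astar j w.1) in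
  let Mt := fun (j : 'I_J.+1) (w : T * T0) => M j w.1 - eta j w in
  let dual := ('E_Pt[max_process (fun (j : 'I_J.+1) (w : T * T0) => (Z j w.1 - Mt j w)%R)])%E in
  [/\ forall j : 'I_J.+1, \forall w \ae Pt,
        eta j w <= Y j w.1 - Z j w.1 + Astar j w.1,
      \forall w \ae P, ((Y 0%N w)%:E <= dual)%E &
      (0 < P [set w | exists2 j, (j <= J)%N & M j w <> Mstar j w])%E ->
        \forall w \ae P, ((Y 0%N w)%:E < dual)%E].
Proof.
move=> Y Mstar Astar eta Mt dual.
have [mM M0 _] := M_opt; have [M_adapted M_int _] := mM.
have [sF mF _] := F_filt.
pose D j w := Y j w - Z j w + Astar j w.
have D_ge0 j : (j <= J)%N -> \forall w \ae P, 0 <= D j w.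
  exact: doob_gap_ge0.
have iY : integrable_process P J Y by exact: integrable_snell.
have S_int j : (j <= J)%N -> P.-integrable setT (EFin \o (fun w => Y j w + Astar j w)).
  by move=> jJ; have [] := snell_add_predictable F_filt Z_adapted Z_int jJ.
have S_mean j : (j <= J)%N -> \int[P]_w (Y j w + Astar j w) = \int[P]_w Y 0%N w.
  by move=> jJ; have [] := snell_add_predictable F_filt Z_adapted Z_int jJ.
have D_int j : (j <= J)%N -> P.-integrable setT (EFin \o D j).
  move=> jJ; rewrite (_ : D j = fun w => (Y j w + Astar j w) - Z j w).
    exact: (integrableB measurableT (S_int _ jJ) (Z_int _ jJ)).
  by apply/funext => w; rewrite /D; ring.
have ZM_int j : (j <= J)%N -> P.-integrable setT (EFin \o (fun w => Z j w - M j w)).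
  by move=> jJ; exact: (integrableB measurableT (Z_int _ jJ) (M_int _ jJ)).
have ordJ (j : 'I_J.+1) : (j <= J)%N by rewrite -ltnS.
have [tau [stau Ztau Dtau]] := snell_optimal_gap F_filt Z_adapted Z_int.
have tauJ w : (tau w < J.+1)%N by case: stau => /(_ w).
pose L w := Z (tau w) w - M (tau w) w.
have L_int : P.-integrable setT (EFin \o L).
  exact: (integrable_stopped F_filt stau (X := fun j w => Z j w - M j w)).
have M_mean j : (j <= J)%N -> \int[P]_w M j w = 0.
  move=> jJ; rewrite -(@Rintegral_martingale _ _ _ P J F F_filt M 0 j setT)//.
    rewrite (_ : 0 = \int[P]_w (cst 0 w)); last by rewrite Rintegral_cst// mul0r.
    apply: ae_eq_Rintegral => //; first exact: M_int.
    exact: finite_measure_integrable_cst.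
  exact: sub_sigma_algebraT (sF _ _).
(* Optimality of [tau] gives the mean of the reward; optional stopping removes [M]. *)
have L_mean : \int[P]_w L w = \int[P]_w Y 0%N w.
  rewrite /L RintegralB//.
  - by rewrite Ztau (optional_stopping F_filt mM stau) M_mean// subr0.
  - exact: (integrable_stopped F_filt stau Z_int).
  - exact: (integrable_stopped F_filt stau M_int).
have dualE : dual = (\int[Pt]_w
    (max_process (fun (j : 'I_J.+1) w => Z j w.1 - Mt j w) w)%:E)%E.
  by rewrite /dual unlock.
set W := max_process _ in dualE.
have WE (j : 'I_J.+1) w : Z j w.1 - Mt j w = (Z j w.1 - M j w.1) + xi j w * D j w.1.
  by rewrite /Mt /eta /D; ring.
(* [L] is the term of the maximum at the random index [tau], where [D] vanishes. *)
have LW : \forall w \ae Pt, L w.1 <= W w.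
  apply: filterS (ae_fst Pt_ext Dtau) => w Dw.
  rewrite (_ : L w.1 = Z (Ordinal (tauJ w.1)) w.1 - Mt (Ordinal (tauJ w.1)) w).
    exact: (le_bigmax (Z ord0 w.1 - Mt ord0 w) (fun j : 'I_J.+1 => Z j w.1 - Mt j w)).
  by rewrite WE /L /= /D Dw mulr0 addr0.
have eta_le (j : 'I_J.+1) : \forall w \ae Pt, eta j w <= D j w.1.
  apply: filterS (ae_fst Pt_ext (D_ge0 _ (ordJ j))) => w Dw.
  by rewrite /eta ler_piMl.
(* An integrable majorant of [W] depending on the first factor only, available since [eta j] is at
   most [D j]. *)
pose U w := \sum_(j < J.+1) (`|Z j w - M j w| + `|D j w|).
have U_int : P.-integrable setT (EFin \o U).
  rewrite (_ : EFin \o U =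
      fun w => (\sum_(j < J.+1) (`|Z j w - M j w| + `|D j w|)%:E)%E).
    apply: integrable_sum => // j _.
    apply: (integrableD measurableT (f := EFin \o (fun w => `|Z j w - M j w|))
      (g := EFin \o (fun w => `|D j w|))).
      exact: integrable_norm (ZM_int _ (ordJ j)).
    exact: integrable_norm (D_int _ (ordJ j)).
  by apply/funext => w; rewrite /= /U -sumEFin.
have WU : \forall w \ae Pt, W w <= U w.1.
  have := filter_forall (ae_filter_ringOfSetsType Pt) eta_le.
  apply: filterS => w eta_w.
  have WjU (j : 'I_J.+1) : Z j w.1 - Mt j w <= U w.1.
    apply: (@le_trans _ _ (`|Z j w.1 - M j w.1| + `|D j w.1|)).
      rewrite /Mt opprB addrCA addrC lerD ?ler_norm//.
      by apply: le_trans (eta_w j) _; exact: ler_norm.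
    rewrite /U (bigD1 j)//= lerDl; apply: sumr_ge0 => i _.
    by rewrite addr_ge0.
  by apply: bigmax_le.
have W_meas : measurable_fun setT W.
  apply: measurable_max_process => j.
  rewrite (_ : (fun _ => _) = fun w => (Z j w.1 - M j w.1) + xi j w * D j w.1).
    apply: measurable_funD.
      exact: (measurableT_comp (integrable_measurable (ZM_int _ (ordJ j))) measurable_fst).
    apply: measurable_funM => //.
    exact: (measurableT_comp (integrable_measurable (D_int _ (ordJ j))) measurable_fst).
  by apply/funext => w; exact: WE.
have iLt := integrable_fst Pt_ext L_int.
have W_int : Pt.-integrable setT (EFin \o W).
  exact: integrable_between W_meas iLt (integrable_fst Pt_ext U_int) LW WU.
have dualW : dual = (\int[Pt]_w W w)%:E.
  by rewrite dualE /Rintegral fineK//; exact: integrable_fin_num.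
have Y0E : \forall w \ae P, Y 0%N w = \int[P]_w Y 0%N w.
  exact: (trivial_snell0 F_filt Z_adapted Z_int F0_trivial).
have Lt_mean : \int[Pt]_w L w.1 = \int[P]_w Y 0%N w.
  by rewrite (Rintegral_fst Pt_ext L_int).
split => //.
  apply: filterS Y0E => w ->; rewrite dualW lee_fin -Lt_mean.
  exact: ae_le_Rintegral.
move=> MneqMstar; apply: filterS Y0E => w ->; rewrite dualW lte_fin.
(* If strictness fails, [W] has mean at most that of [L], which it dominates, so the two agree
   a.s. *)
rewrite ltNge; apply/negP => W_le.
have LWeq : \forall w \ae Pt, L w.1 = W w.
  by apply: ae_le_eq_Rintegral => //; rewrite Lt_mean.
have SL j : (j <= J)%N -> \forall w \ae P, Y j w + Astar j w - M j w = L w.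
  move=> jJ; apply: ae_le_eq_Rintegral => //.
  - exact: (integrableB measurableT (S_int _ jJ) (M_int _ jJ)).
  - pose i : 'I_J.+1 := Ordinal (jJ : (j < J.+1)%N).
    have : \forall w \ae P, (Z j w - M j w) + D j w <= L w.
      apply: (@ae_le_of_randomized _ _ _ _ _ _ Pt Pt_ext (xi i)) => //.
      + move=> B C mB mC; apply: xi_indep_F; last by exists C.
        (* The generators form a union over ordinals; it is reindexed by natural numbers through
           [inord], and index [i] exhibits the event as a generator. *)
        apply: sub_sigma_algebra; rewrite -bigcup_mkord_ord.
        exists (nat_of_ord i); first exact: ltn_ord.
        by rewrite inord_val; exists B => //; rewrite setTI.
      + by move=> e; exact: density_pos (xi_density i) p_cont p1_gt0.
      + exact: integrable_measurable (ZM_int _ jJ).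
      + exact: integrable_measurable (D_int _ jJ).
      + exact: integrable_measurable L_int.
      + exact: D_ge0.
      + apply: filterS LWeq => v ->; rewrite -(WE i).
        exact: (le_bigmax (Z ord0 v.1 - Mt ord0 v) (fun j : 'I_J.+1 => Z j v.1 - Mt j v)).
    by apply: filterS => v; rewrite /D => ?; lra.
  - by rewrite L_mean RintegralB//; [rewrite S_mean// M_mean// subr0|exact: S_int|exact: M_int].
(* By the Doob identity, [SL] at [j] reads [Y 0 + Mstar j - M j = L], while at 0 it reads [Y 0 = L]
   because both martingales start at 0. *)
have MM j : (j <= J)%N -> \forall w \ae P, M j w = Mstar j w.
  move=> jJ; apply: filterS3 (SL _ jJ) (SL _ (leq0n J)) M0 => v.
  rewrite (doob_martingaleE P F Y j v) (doob_martingaleE P F Y 0 v) => <- + M0v.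
  by rewrite M0v [X in _ + X - 0]/doob_martingale big_geq// /Mstar => ?; lra.
suff : P [set v | exists2 j, (j <= J)%N & M j v <> Mstar j v] = 0%E.
  by move=> PM0; rewrite PM0 ltxx in MneqMstar.
have Mstar_meas j : (j <= J)%N -> measurable_fun setT (Mstar j).
  move=> jJ; rewrite (_ : Mstar j = fun v => (Y j v + Astar j v) - Y 0%N v).
    apply: measurable_funB; first exact: integrable_measurable (S_int _ jJ).
    exact: integrable_measurable (iY _ (leq0n J)).
  by apply/funext => v; rewrite (doob_martingaleE P F Y j v) addrC addKr.
(* As a union of the events of disagreement at each time, the set is measurable, so being negligible
   gives it measure zero. *)
rewrite (_ : mkset _ = \bigcup_(j in [set j | (j <= J)%N])
    (setT `&` [set v | (M j v)%:E != (Mstar j v)%:E])).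
  apply: measure_negligible.
    apply: bigcup_measurable => j jJ; apply: measurable_neqe => //.
      exact: measurable_int (M_int _ jJ).
    by apply/measurable_EFinP; exact: Mstar_meas.
  have : \forall v \ae P, forall j, (j <= J)%N -> M j v = Mstar j v.
    apply: ae_foralln => j; have [jJ|Jj] := leqP j J; last exact: aeW.
    by apply: filterS (MM _ jJ) => v.
  apply: negligibleS => v [j jJ [_ /= /eqP neq]] /= /(_ j jJ) eq.
  by apply: neq; rewrite eq.
apply/seteqP; split => v.
  by move=> [j jJ /eqP neq]; exists j.
by move=> [j jJ [_ /= neq]]; exists j => //; apply/eqP.
Qed.
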